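(* Let $p$ be an odd prime, $t,s$ positive integers, $r=p^t$, $q=r^s$, $T=q+1$. Let $\eta$ be the quadratic multiplicative character of $\mathbb{F}_r$ (with $\eta(0)=0$), and let $$D=\{x\in\mathbb{F}_{q^2}:\ \eta(\mathrm{Tr}_{q/r}(x^T))=-1\},\qquad K=\#D=\frac{q(q+1)(r-1)}{2r}.$$ For $a\in\mathbb{F}_{q^2}$ let $\chi_a(x)=\zeta_p^{\mathrm{Tr}_{q^2/p}(ax)}$ ($\zeta_p=e^{2\pi i/p}$) and $\mathbf{c}_a=\frac{1}{\sqrt K}(\chi_a(x))_{x\in D}$, giving the codebook $\{\mathbf{c}_a:a\in\mathbb{F}_{q^2}\}$ with $N=q^2$. Then, as $(a_i,a_j)$ ranges over the $q^2(q^2-1)$ ordered pairs of distinct elements of $\mathbb{F}_{q^2}$, the inner product $\mathbf{c}_{a_i}\mathbf{c}_{a_j}^H$ takes the value $\frac{1}{K}\cdot\frac{r-1}{2r}q$ exactly $\frac{r+1}{2r}q^4-\frac{r-1}{2r}q^3-q^2$ times, and the value $\frac{1}{K}\cdot\frac{-r-1}{2r}q$ exactly $\frac{r-1}{2r}(q^4+q^3)$ times.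
   Context: $\mathrm{Tr}_{q/r}$ is the trace from $\mathbb{F}_q$ to $\mathbb{F}_r$ and $\mathrm{Tr}_{q^2/p}$ the absolute trace of $\mathbb{F}_{q^2}$; note $x^{q+1}\in\mathbb{F}_q$ for $x\in\mathbb{F}_{q^2}$. $\mathbf{c}^H$ is the conjugate transpose. *)

(* Defs.v *)
From mathcomp Require Import all_boot all_order all_algebra all_field.
Set Implicit Arguments. Unset Strict Implicit. Unset Printing Implicit Defensive.
Import GRing.Theory Num.Theory.
Local Open Scope ring_scope.

Section Defs.
Variable F : finFieldType.

Definition relTrace (r s : nat) (y : F) : F := \sum_(i < s) y ^+ (r ^ i).

(* absolute trace Tr_{q^2/p}(y) = sum_{i<m} y^(p^i), with q^2 = p^m *)
Definition absTrace (p m : nat) (y : F) : F := \sum_(i < m) y ^+ (p ^ i).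

(* quadratic character of the subfield F_r = {z | z^r = z} (eta(0) = 0) *)
Definition quadChar (r : nat) (y : F) : int :=
  if y == 0 then 0
  else if [exists z : F, (z ^+ r == z) && (z ^+ 2 == y)] then 1 else -1.

Definition primeFieldIndex (p : nat) (y : F) : nat :=
  odflt 0%N (omap (@nat_of_ord p) [pick k : 'I_p | k%:R == y]).

Definition addChar (p m : nat) (zeta : algC) (a x : F) : algC :=
  zeta ^+ primeFieldIndex p (absTrace p m (a * x)).

Definition defSet (r s T : nat) : {set F} :=
  [set x : F | quadChar r (relTrace r s (x ^+ T)) == -1].

Definition codeword (p m r s T : nat) (zeta : algC) (a x : F) : algC :=
  (sqrtC (#|defSet r s T|%:R))^-1 * addChar p m zeta a x.

Definition innerH (p m r s T : nat) (zeta : algC) (a b : F) : algC :=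
  \sum_(x in defSet r s T)
     codeword p m r s T zeta a x * (codeword p m r s T zeta b x)^*.
End Defs.

(* Main.v *)
Require Import Defs.
From mathcomp Require Import all_boot all_order all_algebra all_field.
From mathcomp Require Import zify ring.
Set Implicit Arguments. Unset Strict Implicit. Unset Printing Implicit Defensive.
Import GRing.Theory Num.Theory.
Local Open Scope ring_scope.

(** Write N(x) = x^(q+1), Q(x) = Tr_{q/r}(N(x)), and let psi_k be the additive
    character of F_(p^k), so that psi_(ts)(y) = psi_t(Tr_{q/r}(y)) on F_q and
    psi_(2ts)(x) = psi_(ts)(x + x^q).  Since N maps F* onto F_q* with fibers of
    size q + 1, the sum of psi_(ts)(c N(x)) over x is -q for c in F_q*, and
    completing the square gives
      sum_x psi_(ts)(c N(x)) psi_(2ts)(b x) = -q psi_(ts)(- N(b) / c).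
    Detecting Q(x) = n by orthogonality in F_r and summing over the
    h = (r - 1) / 2 nonsquares n of F_r, the sum S(b) of psi_(2ts)(b x) over D
    satisfies
      r S(b) = h q^2 [b = 0] - q (r [-Q(b) is a nonsquare] - h).
    The case b = 0 is the size of D.  Multiplication by an element of norm -1
    shows that the b with -Q(b) a nonsquare are as many as the elements of D. *)

(** * Subfields as fixed points of Frobenius powers *)

Definition frobFix (F : finFieldType) (r : nat) : {set F} :=
  [set z | z ^+ r == z].

(** Induction on n: u - v divides u^r - v^r, applied to u = X^(r^n) and v = X. *)
Lemma dvdp_frob (F : fieldType) (r n : nat) :
  ('X^r - 'X : {poly F}) %| 'X^(r ^ n) - 'X.
Proof.
elim: n => [|n IHn]; first by rewrite expn0 expr1 subrr dvdp0.
have -> : 'X^(r ^ n.+1) - 'X = ('X^(r ^ n) ^+ r - 'X^r) + ('X^r - 'X) :> {poly F}.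
  by rewrite addrA subrK -exprM -expnSr.
by rewrite dvdp_add ?dvdpp // subrXX dvdp_mulr.
Qed.

(** X^r - X divides X^|F| - X, the product of the X - z over all z in [F], so it splits into r
    distinct linear factors. *)
Lemma card_frobFix (F : finFieldType) (r n : nat) :
  (1 < r)%N -> #|F| = (r ^ n)%N -> #|frobFix F r| = r.
Proof.
move=> r_gt1 cardF.
have size_frob : size ('X^r - 'X : {poly F}) = r.+1.
  by rewrite size_polyDl ?size_polyXn // size_polyN size_polyX.
have := dvdp_frob F r n; rewrite -cardF finField_genPoly.
(* Up to a scalar, such a divisor is the product over a sublist of [F], selected by the mask [b]. *)
case/dvdp_prod_XsubC=> b frobE.
have uniq_b : uniq (mask b (index_enum F)) by rewrite mask_uniq ?index_enum_uniq.
have : size (mask b (index_enum F)) = r.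
  by move/eqp_size: frobE; rewrite size_frob size_prod_XsubC => -[].
move=> size_b; rewrite -[RHS]size_b -(card_uniqP uniq_b); apply: eq_card => z.
rewrite inE -subr_eq0 -root_prod_XsubC -(eqp_root frobE).
by rewrite /root hornerD hornerN hornerXn hornerX.
Qed.

Lemma frobFixM (F : finFieldType) k (y z : F) :
  y \in frobFix F k -> z \in frobFix F k -> y * z \in frobFix F k.
Proof. by rewrite !inE exprMn => /eqP-> /eqP->. Qed.

Lemma frobFixV (F : finFieldType) k (y : F) :
  y \in frobFix F k -> y^-1 \in frobFix F k.
Proof. by rewrite !inE exprVn => /eqP->. Qed.

(** * Additivity of Frobenius and properties of the traces *)

Section Frobenius.
Variables (F : finFieldType) (p : nat).
Hypothesis charFp : p \in [pchar F].

Lemma frob0 k : (0 : F) ^+ (p ^ k) = 0.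
Proof. by rewrite expr0n expn_eq0 eqn0Ngt prime_gt0 // (pcharf_prime charFp). Qed.

Lemma frobD k : {morph (fun x : F => x ^+ (p ^ k)) : x y / x + y}.
Proof.
move=> x y; apply: exprDn_pchar.
by rewrite (eq_pnat _ (pcharf_eq charFp)) pnatX pnat_id ?(pcharf_prime charFp).
Qed.

Lemma frobN k : {morph (fun x : F => x ^+ (p ^ k)) : x / - x}.
Proof. by move=> x; apply/eqP; rewrite -addr_eq0 -frobD addNr frob0. Qed.

Lemma frob_sum k (I : Type) (s : seq I) (P : pred I) (f : I -> F) :
  (\sum_(i <- s | P i) f i) ^+ (p ^ k) = \sum_(i <- s | P i) f i ^+ (p ^ k).
Proof. exact: (big_morph _ (frobD k) (frob0 k)). Qed.

Lemma relTraceD t s : {morph @relTrace F (p ^ t) s : x y / x + y}.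
Proof.
by move=> x y; rewrite -big_split; apply: eq_bigr => i _; rewrite -expnM frobD.
Qed.

Lemma relTraceN t s : {morph @relTrace F (p ^ t) s : x / - x}.
Proof.
by move=> x; rewrite -sumrN; apply: eq_bigr => i _; rewrite -expnM frobN.
Qed.

Lemma frobFix_exp r i (c : F) : c \in frobFix F r -> c ^+ (r ^ i) = c.
Proof.
rewrite inE => /eqP cr; elim: i => [|i IHi]; first by rewrite expr1.
by rewrite expnSr exprM IHi.
Qed.

Lemma relTraceZ r s (c x : F) :
  c \in frobFix F r -> relTrace r s (c * x) = c * relTrace r s x.
Proof.
move=> rc; rewrite /relTrace mulr_sumr; apply: eq_bigr => i _.
by rewrite exprMn (frobFix_exp _ rc).
Qed.

(** Raising to the power r shifts the terms of the trace cyclically, since the last one, y^(r^s), is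
    y again. *)
Lemma relTrace_fix t s (y : F) :
  y \in frobFix F ((p ^ t) ^ s) -> relTrace (p ^ t) s y \in frobFix F (p ^ t).
Proof.
rewrite /relTrace; case: s => [|s]; first by rewrite big_ord0 !inE frob0.
rewrite !inE => /eqP yq; rewrite frob_sum; apply/eqP.
under eq_bigr do rewrite -exprM -expnSr.
by rewrite big_ord_recr /= yq [RHS]big_ord_recl addrC expr1.
Qed.

Lemma absTraceD a : {morph @absTrace F p a : x y / x + y}.
Proof. exact: (relTraceD 1). Qed.

(** Group the exponents below a b into b blocks of length a; each block is the inner trace of one
    power of y. *)
Lemma relTrace_tower t a b (y : F) :
  relTrace (p ^ t) (a * b) y = relTrace (p ^ t) a (relTrace ((p ^ t) ^ a) b y).
Proof.
elim: b => [|b IHb].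
  rewrite muln0 /relTrace !big_ord0 big1 // => i _.
  by rewrite -expnM frob0.
rewrite mulnSr {1}/relTrace big_split_ord -/(relTrace (p ^ t) (a * b) y) IHb.
rewrite [in RHS]/(relTrace _ b.+1) big_ord_recr relTraceD; congr (_ + _).
by apply: eq_bigr => i _; rewrite -exprM -!expnM -expnD mulnDr.
Qed.

Lemma absTrace_tower a b (y : F) :
  absTrace p (a * b) y = absTrace p a (relTrace (p ^ a) b y).
Proof. by have := relTrace_tower 1 a b y; rewrite !expn1. Qed.

(* The trace polynomial has degree r^(s-1), less than the size r^s of the field. *)
Lemma relTrace_neq0 r s (A : {set F}) : (1 < r)%N -> (0 < s)%N ->
  #|A| = (r ^ s)%N -> exists2 y, y \in A & relTrace r s y != 0.
Proof.
case: s => // s r_gt1 _ cardA; apply/exists_inP; apply: contraPT cardA.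
rewrite negb_exists_in => /forall_inP A0.
pose P : {poly F} := \sum_(i < s.+1) 'X^(r ^ i).
have sizeP : size P = (r ^ s).+1.
  rewrite /P big_ord_recr /= addrC size_polyDl size_polyXn //.
  rewrite ltnS (leq_trans (size_sum _ _ _)) //; apply/bigmax_leqP => i _.
  by rewrite size_polyXn ltn_exp2l.
have P0 : P != 0 by rewrite -size_poly_eq0 sizeP.
have /(max_poly_roots P0) : all (root P) (enum A).
  apply/allP => y; rewrite mem_enum => /A0; rewrite negbK => /eqP tr0.
  rewrite /root horner_sum -[X in _ == X]tr0; apply/eqP/eq_bigr => i _.
  by rewrite hornerXn.
rewrite enum_uniq -cardE sizeP => /(_ isT) cardA eqA.
by move: cardA; rewrite eqA ltnS leqNgt ltn_exp2l ?ltnSn.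
Qed.

Lemma frobFixD k (y z : F) : y \in frobFix F (p ^ k) ->
  (y + z \in frobFix F (p ^ k)) = (z \in frobFix F (p ^ k)).
Proof. by rewrite !inE frobD => /eqP->; rewrite (inj_eq (addrI y)). Qed.

Lemma frobFix0 k : (0 : F) \in frobFix F (p ^ k).
Proof. by rewrite inE frob0. Qed.

Lemma frobFixN k (y : F) :
  (- y \in frobFix F (p ^ k)) = (y \in frobFix F (p ^ k)).
Proof. by rewrite !inE frobN eqr_opp. Qed.

End Frobenius.

(** * Additive characters of subfields and their orthogonality *)

Lemma sum_char_eq0 (F : finZmodType) (A : {set F}) (f : F -> algC) (a : F) :
  {in A &, forall x y, f (x + y) = f x * f y} ->
  (forall y, (a + y \in A) = (y \in A)) -> a \in A -> f a != 1 ->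
  \sum_(x in A) f x = 0.
Proof.
move=> fD stabA Aa fa_neq1; set S := \sum_(x in A) f x.
(* Translation by [a] permutes [A] and multiplies the sum by [f a], which is not 1. *)
have SE : S = f a * S.
  rewrite {1}/S (reindex_inj (addrI a)) mulr_sumr; under eq_bigl do rewrite stabA.
  by apply: eq_bigr => x Ax; rewrite fD.
have : (1 - f a) * S = 0 by rewrite mulrBl mul1r -SE subrr.
by move/eqP; rewrite mulf_eq0 subr_eq0 eq_sym (negPf fa_neq1) => /eqP.
Qed.

(** The character psi_k of F_(p^k), extended to all of [F]. Outside that subfield the trace may
    leave F_p, where [primeFieldIndex] defaults to 0, so additivity is claimed only on the fixed
    set. *)
Definition subChar (F : finFieldType) p (zeta : algC) k (z : F) : algC :=
  zeta ^+ primeFieldIndex p (absTrace p k z).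

Section Characters.
Variables (F : finFieldType) (p n : nat) (zeta : algC).
Hypotheses (p_prime : prime p) (cardF : #|F| = (p ^ n)%N).
Hypothesis zeta_prim : p.-primitive_root zeta.

Let charFp : p \in [pchar F]. Proof. exact: card_finPcharP cardF p_prime. Qed.

Lemma natr_eq_pchar i j : ((i%:R : F) == j%:R) = (i == j %[mod p]).
Proof.
wlog le_ij : i j / (i <= j)%N => [IH|].
  by case/orP: (leq_total i j) => /IH // ji; rewrite eq_sym ji eq_sym.
rewrite eq_sym -subr_eq0 -natrB // -(dvdn_pcharf charFp).
by rewrite [RHS]eq_sym eqn_mod_dvd.
Qed.

(** The classes of 0, ..., p - 1 are p distinct fixed points of x -> x^p, which has exactly p of
    them, so the [pick] in [primeFieldIndex] succeeds. *)
Lemma primeFieldIndexK (y : F) :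
  y \in frobFix F p -> (primeFieldIndex p y)%:R = y.
Proof.
have -> : frobFix F p = [set k%:R | k : 'I_p].
  apply/esym/eqP; rewrite eqEcard (card_frobFix (prime_gt1 p_prime) cardF).
  rewrite card_imset ?card_ord ?leqnn ?andbT; last first.
    move=> i j /eqP; rewrite natr_eq_pchar !modn_small // => /eqP.
    exact: val_inj.
  apply/subsetP => _ /imsetP[k _ ->]; rewrite inE.
  by rewrite -(pFrobenius_autE charFp) pFrobenius_aut_nat.
case/imsetP=> k _ ->; rewrite /primeFieldIndex; case: pickP => [j /eqP //|/(_ k)].
by rewrite eqxx.
Qed.

Lemma absTrace_fix k (z : F) :
  z \in frobFix F (p ^ k) -> absTrace p k z \in frobFix F p.
Proof. by have := @relTrace_fix _ _ charFp 1 k z; rewrite expn1. Qed.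

(** Exponents of [zeta] matter only modulo p, and congruence modulo p is equality of the images in
    [F], where the trace is additive. *)
Lemma subCharD k :
  {in frobFix F (p ^ k) &, {morph @subChar F p zeta k : y z / y + z >-> y * z}}.
Proof.
move=> y z yk zk; rewrite /subChar -exprD; apply/eqP.
have yzk : y + z \in frobFix F (p ^ k) by rewrite frobFixD.
rewrite (eq_prim_root_expr zeta_prim) -natr_eq_pchar natrD.
by rewrite !primeFieldIndexK ?absTrace_fix // absTraceD.
Qed.

Lemma subChar0 k : subChar p zeta k (0 : F) = 1.
Proof.
have z0 := frobFix0 charFp k; apply/eqP; rewrite -(prim_order_dvd zeta_prim).
rewrite (dvdn_pcharf charFp) primeFieldIndexK ?absTrace_fix //.
by rewrite /absTrace big1 // => i _; rewrite (frob0 charFp).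
Qed.

Lemma subChar_neq0 k (z : F) : subChar p zeta k z != 0.
Proof.
by rewrite expf_neq0 // (prim_root_eq0 zeta_prim) eqn0Ngt prime_gt0.
Qed.

(** Orthogonality. As k divides n, the fixed set has p^k elements, hence an element a of nonzero
    trace; for z nonzero, translating c by a / z shows that the sum vanishes. *)
Lemma sum_subChar k m (z : F) : (0 < k)%N -> n = (k * m)%N ->
  z \in frobFix F (p ^ k) ->
  \sum_(c in frobFix F (p ^ k)) subChar p zeta k (c * z)
    = if z == 0 then (p ^ k)%:R else 0.
Proof.
move=> k_gt0 nE zk.
have cardk : #|frobFix F (p ^ k)| = (p ^ k)%N.
  by apply: (@card_frobFix _ _ m); rewrite -?expnM -?nE ?(ltn_exp2l 0) ?prime_gt1.
case: eqVneq => [->|z_neq0].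
  by under eq_bigr do rewrite mulr0 subChar0; rewrite sumr_const cardk.
have [a ak tr_a] := relTrace_neq0 (prime_gt1 p_prime) k_gt0 cardk.
have azk : a / z \in frobFix F (p ^ k) by rewrite frobFixM ?frobFixV.
apply: (@sum_char_eq0 _ _ _ (a / z)) => // [x y xk yk|y|].
- by rewrite mulrDl subCharD ?frobFixM.
- by rewrite frobFixD.
- rewrite divfK // -(prim_order_dvd zeta_prim) (dvdn_pcharf charFp).
  by rewrite primeFieldIndexK // absTrace_fix.
Qed.

Lemma sum_subChar_neq0 k m (z : F) : (0 < k)%N -> n = (k * m)%N ->
  z \in frobFix F (p ^ k) ->
  \sum_(c in frobFix F (p ^ k) :\ 0) subChar p zeta k (c * z)
    = (if z == 0 then (p ^ k)%:R else 0) - 1.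
Proof.
move=> k_gt0 nE zk; rewrite -(sum_subChar k_gt0 nE zk).
rewrite [in RHS](big_setD1 0) ?frobFix0 //=.
by rewrite mul0r subChar0 [1 + _]addrC addrK.
Qed.

Lemma conj_subChar k (z : F) : (subChar p zeta k z)^* = (subChar p zeta k z)^-1.
Proof.
have norm1 : `|subChar p zeta k z| = 1.
  apply/eqP; rewrite -(@pexpr_eq1 _ _ p) ?prime_gt0 ?normr_ge0 //.
  by rewrite -normrX /subChar exprAC (prim_expr_order zeta_prim) expr1n normr1.
by rewrite invC_norm norm1 expr1n invr1 mul1r.
Qed.

Lemma subCharN k (z : F) : z \in frobFix F (p ^ k) ->
  subChar p zeta k (- z) = (subChar p zeta k z)^-1.
Proof.
move=> zk; apply: (mulfI (subChar_neq0 k z)).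
by rewrite mulfV ?subChar_neq0 // -subCharD ?frobFixN // subrr subChar0.
Qed.

End Characters.

(** * The nonsquares of F_r *)

Section NonSquares.
Variables (F : finFieldType) (p t : nat).
Hypotheses (p_prime : prime p) (p_odd : odd p) (charFp : p \in [pchar F]).
Let r := (p ^ t)%N.
Hypothesis card_r : #|frobFix F r| = r.

Definition nonSquares : {set F} := [set n in frobFix F r | quadChar r n == -1].

Lemma quadChar_eqN1 (y : F) : (quadChar r y == -1) =
  (y != 0) && ~~ [exists z : F, (z ^+ r == z) && (z ^+ 2 == y)].
Proof. by rewrite /quadChar; case: (y =P 0) => //= _; case: [exists z, _]. Qed.

Lemma nonSquares_neq0 n : n \in nonSquares -> n != 0.
Proof. by rewrite inE quadChar_eqN1 => /and3P[]. Qed.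

(** Justifies the substitution of n c^2 for n in [sum_ns_char]. One implication suffices: the other
    is its instance at c^-1. *)
Lemma nonSquaresM n c : c \in frobFix F r -> c != 0 ->
  (n * c ^+ 2 \in nonSquares) = (n \in nonSquares).
Proof.
move=> cr c0.
have mulP m d : d \in frobFix F r -> d != 0 ->
    m \in nonSquares -> m * d ^+ 2 \in nonSquares.
  move=> dr d0; rewrite !inE !quadChar_eqN1 mulf_eq0 expf_eq0 (negPf d0) orbF.
  case/and3P=> /eqP mr -> /= nsq.
  move: (dr); rewrite inE => /eqP dr'.
  rewrite exprMn mr exprAC dr' eqxx /=; apply: contra nsq.
  case/existsP=> z /andP[/eqP zr /eqP z2]; apply/existsP; exists (z / d).
  by rewrite exprMn exprVn zr dr' eqxx expr_div_n z2 mulfK ?eqxx // expf_neq0.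
apply/idP/idP; last exact: mulP.
move/(@mulP _ c^-1); rewrite exprVn mulfK ?expf_neq0 // => -> //.
  exact: frobFixV.
by rewrite invr_eq0.
Qed.

(** In odd characteristic z and -z differ for z nonzero, so squaring is two-to-one on the nonzero
    elements of F_r, and half of these are nonsquares. *)
Lemma card_nonSquares : r = (#|nonSquares|.*2).+1.
Proof.
pose sq := [set z ^+ 2 | z in frobFix F r :\ 0].
have r0 : 0 \in frobFix F r by rewrite inE (frob0 charFp).
have sq_r : sq \subset frobFix F r :\ 0.
  apply/subsetP => _ /imsetP[z + ->]; rewrite !inE => /andP[z0 /eqP zr].
  by rewrite expf_neq0 // exprAC zr eqxx.
have nsE : nonSquares = (frobFix F r :\ 0) :\: sq.
  apply/setP => y; rewrite in_set quadChar_eqN1 in_setD in_setD1.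
  rewrite andbCA [RHS]andbC -andbA; case: eqVneq => //= y0; congr (_ && _).
  congr (~~ _); apply/existsP/imsetP => [[z /andP[zr /eqP z2]]|[z]].
    exists z; rewrite // !inE zr andbT.
    by apply: contra_neq y0 => z0; rewrite -z2 z0 expr0n.
  by rewrite !inE => /andP[_ zr] ->; exists z; rewrite zr eqxx.
have two0 : (2%:R : F) != 0.
  rewrite -(dvdn_pcharf charFp) dvdn_prime2 //.
  by apply: contraTneq p_odd => ->.
have card_sq : #|frobFix F r :\ 0| = (#|sq|.*2)%N.
  rewrite -sum1_card (partition_big_imset (fun z => z ^+ 2)) /= -/sq.
  rewrite -muln2 -sum_nat_const; apply: eq_bigr => _ /imsetP[z zr ->].
  rewrite sum1_card -[RHS](_ : #|[set z; - z]| = 2%N); last first.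
    by rewrite cards2 -addr_eq0 -mulr2n -mulr_natr mulf_eq0 negb_or two0;
       case/setD1P: zr => ->.
  apply: eq_card => y; rewrite !inE unfold_in /= eqf_sqr.
  rewrite !inE; case/setD1P: zr => z0 zr; rewrite inE in zr.
  apply: andb_idl => /orP[/eqP->|/eqP->]; first by rewrite z0.
  by rewrite oppr_eq0 z0 (frobN charFp) eqr_opp.
have := cardsD1 0 (frobFix F r); rewrite r0 card_r.
have -> : #|nonSquares| = #|sq|.
  by rewrite nsE -[LHS](addKn #|sq|) -{1}(setIidPr sq_r) cardsID card_sq; lia.
by rewrite card_sq.
Qed.

End NonSquares.

(** * Character sums of the norm and over the defining set *)

Section NormSums.
Variables (p t s : nat) (F : finFieldType) (zeta : algC).
Hypotheses (p_prime : prime p) (p_odd : odd p) (t_gt0 : (0 < t)%N).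
Hypotheses (s_gt0 : (0 < s)%N) (cardF : #|F| = (p ^ (2 * (t * s)))%N).
Hypothesis zeta_prim : p.-primitive_root zeta.
Let r := (p ^ t)%N.
Let q := (p ^ (t * s))%N.

Notation Fr := (frobFix F r).
Notation Fq := (frobFix F q).
Notation psi k := (@subChar F p zeta k).
Notation ns := (nonSquares F p t).

Let charFp : p \in [pchar F]. Proof. exact: card_finPcharP cardF p_prime. Qed.

Let p_gt1 : (1 < p)%N. Proof. exact: prime_gt1. Qed.
Let ts_gt0 : (0 < t * s)%N. Proof. by rewrite muln_gt0 t_gt0. Qed.
Let q_gt1 : (1 < q)%N. Proof. by rewrite -(expn0 p) ltn_exp2l. Qed.
Let r_gt1 : (1 < r)%N. Proof. by rewrite -(expn0 p) ltn_exp2l. Qed.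
Let qE : q = (r ^ s)%N. Proof. by rewrite /q expnM. Qed.
Let cardFq2 : #|F| = (q ^ 2)%N. Proof. by rewrite cardF mulnC expnM. Qed.

Let card_Fq : #|Fq| = q. Proof. exact: card_frobFix cardFq2. Qed.
Let card_Fr : #|Fr| = r.
Proof. by apply: (@card_frobFix _ _ (s * 2)); rewrite // expnM -qE. Qed.

Let frob2K (x : F) : (x ^+ q) ^+ q = x.
Proof. by rewrite -exprM mulnn -cardFq2 expf_card. Qed.

Let frobFixT (x : F) : x \in frobFix F (p ^ (2 * (t * s))).
Proof. by rewrite inE -cardF expf_card. Qed.

Let Fr_Fq : {subset Fr <= Fq}.
Proof. by move=> c cr; rewrite inE qE (frobFix_exp _ cr). Qed.

Let psi0 := subChar0 p_prime cardF zeta_prim.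
Let psiD := subCharD p_prime cardF zeta_prim.

Lemma norm_Fq (x : F) : x ^+ q.+1 \in Fq.
Proof. by rewrite inE exprS exprMn frob2K mulrC. Qed.

(** A fiber consists of roots of X^(q+1) - y, so it has at most q + 1 elements. The q - 1 fibers
    over nonzero norms share q^2 - 1 = (q - 1)(q + 1) elements, so every bound is attained. *)
Lemma card_norm_fiber (y : F) : y \in Fq -> y != 0 ->
  #|[set x : F | x ^+ q.+1 == y]| = q.+1.
Proof.
pose fib y := #|[set x : F | x ^+ q.+1 == y]|.
have fib_le z : (fib z <= q.+1)%N.
  pose P : {poly F} := 'X^(q.+1) - z%:P.
  have sizeP : size P = q.+2 by rewrite size_XnsubC.
  have P0 : P != 0 by rewrite -size_poly_eq0 sizeP.
  rewrite -ltnS -sizeP /fib cardE; apply: max_poly_roots => //; last exact: enum_uniq.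
  apply/allP => x; rewrite mem_enum inE => /eqP xz.
  by rewrite /root hornerD hornerN hornerXn hornerC xz subrr.
have sum_fib : (\sum_(z in Fq :\ 0%R) fib z = \sum_(z in Fq :\ 0%R) q.+1)%N.
  rewrite sum_nat_const.
  have := cardsD1 (0 : F) Fq; rewrite frobFix0 // card_Fq => card_q1.
  transitivity #|[set~ (0 : F)]|.
    rewrite -sum1_card; apply/esym.
    rewrite (partition_big (fun x => x ^+ q.+1) (mem (Fq :\ 0))) /=.
      apply: eq_bigr => z; rewrite !inE => /andP[z0 _].
      rewrite /fib -sum1_card; apply: eq_bigl => x; rewrite !inE.
      apply: andb_idl => /eqP xz; apply: contraNneq z0 => x0.
      by rewrite -xz x0 expr0n.
    by move=> x; rewrite in_setC1 in_setD1 norm_Fq andbT expf_eq0.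
  have -> : #|Fq :\ 0| = q.-1 by rewrite [X in X.-1]card_q1.
  by rewrite cardsC1 cardFq2 -mulnn; move: q_gt1; clear; nia.
move=> yq y0; apply/eqP; move: sum_fib => /eqP.
rewrite (leqif_sum (fun z _ => leqif_eq (fib_le z))) => /forall_inP; apply.
by rewrite in_setD1 y0.
Qed.

(** Group x by its norm: norm 0 contributes 1, and the nonzero norms contribute q + 1 times -1, the
    sum of a nontrivial character over the nonzero elements of F_q. *)
Lemma sum_norm_char (c : F) : c \in Fq -> c != 0 ->
  \sum_(x : F) psi (t * s) (c * x ^+ q.+1) = - q%:R.
Proof.
move=> cq c0.
rewrite (partition_big (fun x => x ^+ q.+1) (mem Fq)) => [|x _]; last exact: norm_Fq.
transitivity (\sum_(y in Fq) psi (t * s) (y * c) *+ (if y == 0 then 1 else q.+1)).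
  apply: eq_bigr => y yq; rewrite (eq_bigr (fun=> psi (t * s) (y * c))).
    rewrite sumr_const /=; congr (_ *+ _); case: eqVneq => [->|y0].
      rewrite (@eq_card1 _ 0) // => x.
      by rewrite [LHS]unfold_in; apply: (expf_eq0 x q.+1).
    by apply: etrans (card_norm_fiber yq y0); apply: eq_card => x; rewrite inE.
  by move=> x /andP[_ /eqP->]; rewrite mulrC.
rewrite (big_setD1 0) ?frobFix0 //= eqxx mul0r psi0.
rewrite (eq_bigr (fun y => psi (t * s) (y * c) *+ q.+1)); last first.
  by move=> y /setD1P[/negPf->].
rewrite sumrMnl.
have -> := sum_subChar_neq0 p_prime cardF zeta_prim ts_gt0 (mulnC _ _) cq.
by rewrite (negPf c0) sub0r mulNrn mulr1n mulrSr opprD addrC subrK.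
Qed.

Lemma subChar_relTrace (y : F) : psi (t * s) y = psi t (relTrace r s y).
Proof. by rewrite /subChar absTrace_tower. Qed.

Lemma subChar_half (x : F) : psi (2 * (t * s)) x = psi (t * s) (x + x ^+ q).
Proof.
rewrite /subChar mulnC absTrace_tower // [relTrace _ 2 _]/relTrace.
rewrite !big_ord_recl big_ord0.
by rewrite addr0 expr1.
Qed.

(* c N(x + b^q / c) = c N(x) + (b x + (b x)^q) + N(b) / c. *)
Lemma sum_norm_char_shift (c b : F) : c \in Fq -> c != 0 ->
  \sum_(x : F) psi (t * s) (c * x ^+ q.+1) * psi (2 * (t * s)) (b * x)
    = - q%:R * psi (t * s) (- (b ^+ q.+1 / c)).
Proof.
move=> cq c0; rewrite -(sum_norm_char cq c0) mulr_suml.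
rewrite [RHS](reindex_inj (addrI (b ^+ q / c))); apply: eq_bigr => x _.
have cN z : c * z ^+ q.+1 \in Fq by rewrite frobFixM ?norm_Fq.
have trF z : z + z ^+ q \in Fq.
  by rewrite inE (frobD charFp) frob2K addrC.
have bN : - (b ^+ q.+1 / c) \in Fq.
  by rewrite frobFixN // frobFixM ?frobFixV ?norm_Fq.
rewrite subChar_half -(psiD (cN x) (trF _)) -(psiD (cN _) bN).
congr (psi _ _); move: cq; rewrite inE => /eqP cq.
rewrite !exprS (frobD charFp) !exprMn exprVn frob2K cq.
by field.
Qed.

Definition traceNorm (x : F) : F := relTrace r s (x ^+ q.+1).

Lemma traceNorm_Fr x : traceNorm x \in Fr.
Proof. by apply: relTrace_fix => //; rewrite -/r -qE norm_Fq. Qed.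

Lemma traceNorm0 : traceNorm 0 = 0.
Proof.
rewrite /traceNorm expr0n /= /relTrace big1 // => i _.
by rewrite expr0n expn_eq0 eqn0Ngt (ltnW r_gt1).
Qed.

Lemma defSetE : defSet F r s q.+1 = [set x | traceNorm x \in ns].
Proof.
apply/setP => x; rewrite !inE -/(traceNorm x).
by move: (traceNorm_Fr x); rewrite inE => ->.
Qed.

Definition defSum (b : F) : algC :=
  \sum_(x in defSet F r s q.+1) psi (2 * (t * s)) (b * x).

Lemma sum_ns_char (u : F) : u \in Fr ->
  \sum_(n in ns) \sum_(c in Fr :\ 0) psi t (- (c * n)) * psi t (- (u / c))
  = r%:R * (- u \in ns)%:R - #|ns|%:R.
Proof.
move=> ur.
(* Replacing c by 1 / c and then n by n c^2 turns -(c n) - u / c into -c (n + u), which is linear in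
   c. *)
transitivity (\sum_(n in ns) \sum_(c in Fr :\ 0) psi t (c * (- (n + u)))).
  rewrite exchange_big [RHS]exchange_big /= (reindex_inj invr_inj).
  apply: eq_big => [c|c]; rewrite in_setD1.
    by rewrite in_setD1 invr_eq0 !inE exprVn (inj_eq invr_inj).
  case/andP; rewrite invr_eq0 => c0 cVr.
  have cr : c \in Fr by rewrite -[c]invrK frobFixV.
  rewrite (reindex_inj (mulIf (expf_neq0 2 c0))).
  apply: eq_big => [n|n]; first by rewrite nonSquaresM.
  rewrite nonSquaresM // => nns.
  have nr : n \in Fr by move: nns; rewrite inE => /andP[].
  rewrite -psiD ?frobFixN // ?frobFixM ?frobFixV //; congr (psi _ _).
  by rewrite invrK; field.
have nsr n : n \in ns -> n \in Fr by rewrite inE => /andP[].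
(* Orthogonality in c; the -1 accounts for the missing term c = 0. *)
transitivity (\sum_(n in ns) ((if n == - u then r%:R else 0) - 1) : algC).
  apply: eq_bigr => n /nsr nr.
  rewrite (sum_subChar_neq0 (m := s * 2) p_prime cardF zeta_prim t_gt0).
  - by rewrite oppr_eq0 addr_eq0.
  - by rewrite mulnC mulnA.
  - by rewrite frobFixN // frobFixD.
rewrite big_split /= sumr_const mulNrn; congr (_ - _).
case: (boolP (- u \in ns)) => [uns|uns].
  rewrite (bigD1 (- u)) //= eqxx big1 ?addr0 ?mulr1 // => n /andP[_ /negPf->] //.
rewrite big1 ?mulr0 // => n nns; case: eqP => // nu.
by rewrite -nu nns in uns.
Qed.

Lemma defSumE (b : F) : r%:R * defSum b =
  #|ns|%:R * (b == 0)%:R * q%:R ^+ 2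
  - q%:R * (r%:R * (- traceNorm b \in ns)%:R - #|ns|%:R).
Proof.
have nsr n : n \in ns -> n \in Fr by rewrite inE => /andP[].
pose P b x := psi (2 * (t * s)) (b * x).
(* The sum over c is r if Q(x) = n and 0 otherwise, so summing over n gives r times the indicator of
   D. *)
transitivity (\sum_(x : F) \sum_(n in ns) \sum_(c in Fr)
   psi t (c * (traceNorm x - n)) * P b x).
  rewrite /defSum defSetE mulr_sumr big_mkcond /=; apply: eq_bigr => x _.
  under eq_bigr => n nns.
    rewrite -mulr_suml (sum_subChar (m := s * 2) p_prime cardF zeta_prim t_gt0);
      [|by rewrite mulnC mulnA|by rewrite frobFixD ?traceNorm_Fr // frobFixN // nsr].
    rewrite subr_eq0 eq_sym.
    over.
  rewrite -mulr_suml inE.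
  case: (boolP (traceNorm x \in ns)) => xns.
    by rewrite (bigD1 _ xns) //= eqxx big1 ?addr0 // => n /andP[_ /negPf->].
  rewrite big1 ?mul0r // => n nns; case: eqP => // nx.
  by rewrite -nx nns in xns.
rewrite exchange_big /=; under eq_bigr do rewrite exchange_big /=.
under eq_bigr => n nns.
  rewrite (big_setD1 0) ?frobFix0 //=.
  under eq_bigr do rewrite mul0r psi0 mul1r.
  over.
rewrite big_split sumr_const /=; congr (_ + _).
  (* Terms with c = 0: each n contributes the full sum of [P b x], evaluated by orthogonality for
     the fixed set that is all of [F]. *)
  rewrite -[LHS]mulr_natl -[RHS]mulrA; congr (_ * _).
  transitivity (if b == 0 then (p ^ (2 * (t * s)))%:R else 0 : algC).
    rewrite -(sum_subChar (m := 1) p_prime cardF zeta_prim _ _ (frobFixT b))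
      ?muln1 ?muln_gt0 ?t_gt0 ?s_gt0 //.
    by apply: eq_big => [x|x _]; rewrite ?frobFixT // mulrC.
  rewrite -cardF cardFq2 natrX; case: eqP => _; first by rewrite mul1r.
  by rewrite mul0r.
rewrite -(sum_ns_char (traceNorm_Fr b)) -mulNr mulr_sumr.
apply: eq_bigr => n nns; rewrite mulr_sumr; apply: eq_bigr => c /setD1P[c0 cr].
(* For c nonzero in F_r, linearity of the trace turns psi_t(c Q(x)) into psi_(ts)(c N(x)), so
   [sum_norm_char_shift] applies. *)
transitivity (psi t (- (c * n)) * \sum_(x : F) psi (t * s) (c * x ^+ q.+1) * P b x).
  rewrite mulr_sumr; apply: eq_bigr => x _; rewrite mulrA; congr (_ * _).
  have nr := nsr n nns.
  rewrite mulrBr addrC psiD ?frobFixN ?frobFixM ?traceNorm_Fr //.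
  by rewrite subChar_relTrace relTraceZ.
rewrite (sum_norm_char_shift b (Fr_Fq cr) c0) mulrCA; congr (_ * (_ * _)).
rewrite subChar_relTrace // mulrC; congr (psi _ _).
by rewrite relTraceN // relTraceZ ?frobFixV // mulrC.
Qed.

(** The set on the left is where [defSum] takes its negative value; this ties its size to K. *)
Lemma card_oppDefSet :
  #|[set b | - traceNorm b \in ns]| = #|defSet F r s q.+1|.
Proof.
have N1q : -1 \in Fq by rewrite inE (frobN charFp) expr1n.
have N1_neq0 : -1 != 0 :> F by rewrite oppr_eq0 oner_eq0.
have /card_gt0P[x0] : (0 < #|[set x : F | (x ^+ q.+1 == -1)%R]|)%N.
  by rewrite card_norm_fiber.
rewrite inE => /eqP x0N.
have x0_neq0 : x0 != 0.
  by apply: contraNneq N1_neq0 => x00; rewrite -x0N x00 expr0n.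
rewrite -(card_imset _ (mulfI x0_neq0)); apply: eq_card => x.
rewrite defSetE inE; apply/imsetP/idP => [[b + ->]|xns].
  by rewrite inE /traceNorm exprMn x0N mulN1r relTraceN.
exists (x / x0); last by rewrite mulrC divfK.
by rewrite inE /traceNorm exprMn exprVn x0N invrN1 mulrN1 relTraceN // opprK.
Qed.

Lemma defSum0 : defSum 0 = #|defSet F r s q.+1|%:R.
Proof.
by rewrite /defSum; under eq_bigr do rewrite mul0r psi0; rewrite sumr_const.
Qed.

Lemma natr_card_nonSquares : #|ns|%:R = (r%:R - 1) / 2 :> algC.
Proof.
have := card_nonSquares p_prime p_odd charFp card_Fr; rewrite -/r => ->.
by rewrite -natr1 -muln2 natrM; field.
Qed.

(** Take b = 0 in [defSumE]: -Q(0) = 0 is not a nonsquare, so r |D| = h q^2 + q h with h = (r - 1) /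
    2. *)
Lemma card_defSet : #|defSet F r s q.+1|%:R =
  q%:R * (q%:R + 1) * (r%:R - 1) / (2 * r%:R) :> algC.
Proof.
have r0 : r%:R != 0 :> algC by rewrite pnatr_eq0 -lt0n ltnW.
have ns0 : (- traceNorm 0 \in ns) = false.
  apply/negP => /nonSquares_neq0; by rewrite traceNorm0 oppr0 eqxx.
have := defSumE 0; rewrite eqxx ns0 natr_card_nonSquares => S0.
by apply: (mulfI r0); rewrite -defSum0 S0 mulr1n mulr0n mulr1 mulr0; field.
Qed.

Lemma defSum_neq0 (b : F) : b != 0 -> defSum b =
  if - traceNorm b \in ns then (- r%:R - 1) / (2 * r%:R) * q%:R
  else (r%:R - 1) / (2 * r%:R) * q%:R.
Proof.
move=> b0; have r0 : r%:R != 0 :> algC by rewrite pnatr_eq0 -lt0n ltnW.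
apply: (mulfI r0); rewrite defSumE (negPf b0) natr_card_nonSquares.
by case: ifP => _; rewrite ?mulr1n !mulr0n; field.
Qed.

(** Character values are roots of unity, so conjugation inverts them and only a - b remains; the two
    normalizing factors multiply to 1 / K. *)
Lemma innerHE (a b : F) : innerH p (2 * (t * s)) r s q.+1 zeta a b =
  #|defSet F r s q.+1|%:R^-1 * defSum (a - b).
Proof.
rewrite /innerH /defSum mulr_sumr; apply: eq_bigr => x _.
rewrite /codeword rmorphM /= conj_Creal; last first.
  by rewrite rpredV ger0_real // sqrtC_ge0 ler0n.
rewrite mulrACA -expr2 exprVn sqrtCK; congr (_ * _).
rewrite -/(subChar p zeta (2 * (t * s)) (a * x)).
rewrite -/(subChar p zeta (2 * (t * s)) (b * x)).
rewrite (conj_subChar p_prime zeta_prim) -(subCharN p_prime cardF zeta_prim) //.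
by rewrite -psiD // -mulNr -mulrDl.
Qed.

End NormSums.

(** * Counting ordered pairs by their difference *)

Lemma card_pair_subr (V : finZmodType) (P : pred V) :
  #|[set ab : V * V | P (ab.1 - ab.2)]| = (#|V| * #|[set d | P d]|)%N.
Proof.
(* A pair is rebuilt from its second entry b and its difference d as (d + b, b). *)
pose f (x : V * V) := (x.2 + x.1, x.1).
have f_inj : injective f by move=> [b d] [b' d'] [+ eb]; rewrite /= eb => /addIr ->.
rewrite -cardsT -cardsX -[RHS](card_imset _ f_inj); apply: eq_card => -[a b].
rewrite inE /=; apply/idP/imsetP => [Pab|[[b' d] + [-> ->]]].
  by exists (b, a - b); rewrite ?inE //= /f /= subrK.
by rewrite !inE /= addrK.
Qed.

Theorem mainTheorem6 (p t s : nat) (F : finFieldType) (zeta : algC) :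
  prime p -> odd p -> (0 < t)%N -> (0 < s)%N ->
  #|F| = (((p ^ t) ^ s) ^ 2)%N ->
  primitive_root_of_unity p zeta ->
  let r := (p ^ t)%N in
  let q := (r ^ s)%N in
  let T := q.+1 in
  let m := (2 * (t * s))%N in
  let K := #|defSet F r s T| in
  let ip := innerH p m r s T zeta in
  let v1 : algC := (K%:R)^-1 * ((r%:R - 1) / (2 * r%:R) * q%:R) in
  let v2 : algC := (K%:R)^-1 * ((- r%:R - 1) / (2 * r%:R) * q%:R) in
  [/\ (K%:R : algC) = q%:R * (q%:R + 1) * (r%:R - 1) / (2 * r%:R),
      (#|[set ab : F * F | (ab.1 != ab.2) && (ip ab.1 ab.2 == v1)]|%:R : algC)
        = (r%:R + 1) / (2 * r%:R) * q%:R ^+ 4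
          - (r%:R - 1) / (2 * r%:R) * q%:R ^+ 3 - q%:R ^+ 2
    & (#|[set ab : F * F | (ab.1 != ab.2) && (ip ab.1 ab.2 == v2)]|%:R : algC)
        = (r%:R - 1) / (2 * r%:R) * (q%:R ^+ 4 + q%:R ^+ 3)].
Proof.
move=> p_prime p_odd t_gt0 s_gt0 cardF zeta_prim r q T m K ip v1 v2.
have cardFm : #|F| = (p ^ (2 * (t * s)))%N.
  by rewrite cardF mulnC -!expnM mulnA.
have qE : q = (p ^ (t * s))%N by rewrite expnM.
have cardK : K%:R = q%:R * (q%:R + 1) * (r%:R - 1) / (2 * r%:R) :> algC.
  by rewrite /K /T qE; apply: card_defSet cardFm zeta_prim.
have p_gt1 := prime_gt1 p_prime.
have r_gt1 : (1 < r)%N by rewrite -(expn0 p) ltn_exp2l.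
have q_gt1 : (1 < q)%N by rewrite -(expn0 r) ltn_exp2l.
have r0 : r%:R != 0 :> algC by rewrite pnatr_eq0 -lt0n ltnW.
have q0 : q%:R != 0 :> algC by rewrite pnatr_eq0 -lt0n ltnW.
have r2V : (2 * r%:R)^-1 != 0 :> algC.
  by rewrite invr_eq0 mulf_neq0 ?(pnatr_eq0 _ 2).
(* Since r > 1, the closed form of K has no zero factor; K^-1 can then be cancelled when [v1] and
   [v2] are compared. *)
have K0 : K%:R != 0 :> algC.
  have q1 : q%:R + 1 != 0 :> algC by rewrite natr1 pnatr_eq0.
  have r1 : r%:R - 1 != 0 :> algC by rewrite subr_eq0 (eqr_nat _ r 1) gtn_eqF.
  by rewrite cardK; do 3![apply: mulf_neq0 => //].
(* [B] collects the differences that produce [v2]; it avoids 0, so equal pairs are not counted. *)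
pose B : {set F} := [set b | - traceNorm p t s b \in nonSquares F p t].
have cardB : #|B| = K by rewrite /K /T qE; apply: card_oppDefSet cardFm.
have B0 : 0 \notin B.
  rewrite inE traceNorm0 // oppr0.
  by apply/negP => /nonSquares_neq0; rewrite eqxx.
have ipE a b : a != b -> ip a b = if a - b \in B then v2 else v1.
  rewrite -subr_eq0 => ab; rewrite /v1 /v2 /ip /K /T qE inE.
  rewrite (innerHE p_prime cardFm zeta_prim).
  rewrite (defSum_neq0 p_prime p_odd t_gt0 s_gt0 cardFm zeta_prim ab).
  by case: ifP.
(* After cancelling the common factors and the summand -1, equality would mean -r = r. *)
have v12 : v2 != v1.
  have KV0 : K%:R^-1 != 0 :> algC by rewrite invr_eq0.
  rewrite (inj_eq (mulfI KV0)) (inj_eq (mulIf q0)) (inj_eq (mulIf r2V)).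
  by rewrite (inj_eq (addIr _)) eqNr.
split=> //.
(* The nonzero differences outside [B] give [v1]; there are q^2 - 1 - K of them, each from q^2
   pairs. *)
- pose C : {set F} := ~: (0 |: B).
  have -> : [set ab : F * F | (ab.1 != ab.2) && (ip ab.1 ab.2 == v1)]
      = [set ab | ab.1 - ab.2 \in C].
    apply/setP => -[a b]; rewrite 2!in_set /= in_setC in_setU1 negb_or subr_eq0.
    case: (eqVneq a b) => //= ab; rewrite ipE //.
    by case: ifP; rewrite ?eqxx ?(negPf v12).
  rewrite card_pair_subr natrM.
  have -> : [set d | d \in C] = C by apply/setP => d; rewrite inE.
  have -> : #|C|%:R = q%:R ^+ 2 - 1 - K%:R :> algC.
    have := cardsC (0 |: B); rewrite cardsU1 B0 cardB cardF -/r -/q.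
    move/(congr1 (fun k => k%:R : algC)); rewrite natrX => <-.
    by rewrite -/C !natrD mulr1n; ring.
  by rewrite cardF -/r -/q natrX cardK; field.
- have -> : [set ab : F * F | (ab.1 != ab.2) && (ip ab.1 ab.2 == v2)]
      = [set ab | ab.1 - ab.2 \in B].
    apply/setP => -[a b]; rewrite 2!in_set /=.
    case: (eqVneq a b) => [->|ab]; first by rewrite subrr (negPf B0).
    rewrite ipE //; case: ifP; rewrite ?eqxx //.
    by rewrite eq_sym (negPf v12).
  rewrite card_pair_subr natrM cardF -/r -/q natrX.
  have -> : [set d | d \in B] = B by apply/setP => d; rewrite inE.
  by rewrite cardB cardK; field.
Qed.
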